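(* For every graph $G$ of order greater than $1$, we have $\textnormal{ftadim}(G) \le \textnormal{adim}(G)+2^{\textnormal{adim}(G)}$.
   Context: Graphs are finite, simple, undirected, possibly disconnected; $\textnormal{dist}(u,v)=\infty$ between different components. A set $S=\{v_1,\dots,v_k\}$ of vertices is an adjacency resolving set of $G$ if the vectors $(\min(2,\textnormal{dist}(u,v_1)),\dots,\min(2,\textnormal{dist}(u,v_k)))$ are pairwise distinct over $u\in V(G)$. The adjacency dimension $\textnormal{adim}(G)$ is the minimum size of an adjacency resolving set. The fault-tolerant adjacency dimension $\textnormal{ftadim}(G)$ is the minimum size of a nonempty $S\subseteq V(G)$ such that $S-\{s\}$ is an adjacency resolving set for every $s\in S$. *)

(* Defs.v *)
From mathcomp Require Import all_boot.
Set Implicit Arguments.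
Unset Strict Implicit.
Unset Printing Implicit Defensive.

(* Finite simple undirected graphs, possibly disconnected. *)
Record sgraph := SGraph {
  vertex :> finType;
  adj : rel vertex;
  adj_sym : symmetric adj;
  adj_irrefl : irreflexive adj
}.

Section Distance.
Variable G : sgraph.
Implicit Types u v : G.

Definition has_walk u v (n : nat) : bool :=
  [exists p : n.-tuple G, path (@adj G) u p && (last u p == v)].

Lemma connect_has_walk u v :
  connect (@adj G) u v -> exists n, has_walk u v n.
Proof.
case/connectP=> p up ->; exists (size p).
by apply/existsP; exists (in_tuple p); rewrite /= up eqxx.
Qed.

(* [None] stands for an infinite distance. *)
Definition dist u v : option nat :=
  match decP (@idP (connect (@adj G) u v)) with
  | left uv => Some (ex_minn (connect_has_walk uv))
  | right _ => None
  end.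

(* min(2, dist(u, v)), so that the infinite distance is sent to 2. *)
Definition adist u v : nat := if dist u v is Some d then minn 2 d else 2.

Lemma adist_eq0 u v : (adist u v == 0) = (u == v).
Proof.
rewrite /adist /dist; case: decP => [uv | nuv].
- case: ex_minnP => n /existsP[p /andP[_ /eqP pv]] nmin.
  apply/idP/eqP => [n0 | euv].
    case: n p pv nmin n0 => [p pv _ _|n p _ _]; last by rewrite -leqn0 geq_min.
    by rewrite -pv (tuple0 p).
  suff: n <= 0 by rewrite leqn0 => /eqP->.
  by apply: nmin; apply/existsP; exists [tuple]; rewrite /= euv eqxx.
- by apply/esym/eqP => euv; apply: nuv; rewrite euv connect0.
Qed.

End Distance.

Section AdjacencyDimension.
Variable G : sgraph.
Implicit Types S : {set G}.

Definition adj_vector S (u : G) : seq nat := [seq adist u s | s in S].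

Definition adj_resolving S : bool := injectiveb (adj_vector S).

Definition ft_adj_resolving S : bool :=
  (S != set0) && [forall s in S, adj_resolving (S :\ s)].

(* [arg min] is a genuine minimum as soon as the default [setT] satisfies the
   predicate: see [adimP] and [ftadimP].  The graph without vertices has no
   nonempty set of vertices, and its [ftadim] is then a junk value. *)
Definition adim : nat := #|[arg min_(S < setT | adj_resolving S) #|S|]|.

Definition ftadim : nat := #|[arg min_(S < setT | ft_adj_resolving S) #|S|]|.

Lemma adj_resolvingD1 (s : G) : adj_resolving (setT :\ s).
Proof.
have key u w : adj_vector (setT :\ s) u = adj_vector (setT :\ s) w ->
    u != s -> w = u.
  move/eq_in_map => uw us; apply/eqP; rewrite -adist_eq0 -uw ?adist_eq0 //.
  by rewrite mem_enum !inE us.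
apply/injectiveP => u w uw.
have [us | /(key _ _ uw) //] := eqVneq u s.
by have [-> // | /(key _ _ (esym uw))] := eqVneq w s.
Qed.

Lemma adj_resolvingT : adj_resolving setT.
Proof.
apply/injectiveP => u w /eq_in_map uw; apply/eqP.
by rewrite -adist_eq0 uw ?adist_eq0 ?mem_enum ?inE.
Qed.

Lemma adimP :
  (exists2 S, adj_resolving S & #|S| = adim)
  /\ (forall S, adj_resolving S -> adim <= #|S|).
Proof.
rewrite /adim; case: arg_minnP => [|S rS Smin]; first exact: adj_resolvingT.
by split=> //; exists S.
Qed.

Lemma ftadimP : 0 < #|G| ->
  (exists2 S, ft_adj_resolving S & #|S| = ftadim)
  /\ (forall S, ft_adj_resolving S -> ftadim <= #|S|).
Proof.
move=> G0; rewrite /ftadim; case: arg_minnP => [|S rS Smin]; last first.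
  by split=> //; exists S.
rewrite /ft_adj_resolving -card_gt0 cardsT G0 /=.
by apply/forall_inP => s _; apply: adj_resolvingD1.
Qed.

End AdjacencyDimension.

(* Main.v *)
(* A vertex outside a resolving set [S] has truncated distance 1 or 2 to each
   element of [S], so it is determined by the subset of [S] at distance 1. Hence
   [G] has at most [#|S| + 2 ^ #|S|] vertices, and the set of all vertices is
   always fault-tolerant. *)
Require Import Defs.
From mathcomp Require Import all_boot.

Lemma adist_le2 (G : sgraph) (u v : G) : adist u v <= 2.
Proof. by rewrite /adist; case: dist => // d; apply: geq_minl. Qed.

(** Distinct vertices exclude the value 0, so a single bit fixes the truncated distance. *)
Lemma adist_neq (G : sgraph) (u v : G) :
  u != v -> adist u v = if adist u v == 1 then 1 else 2.
Proof.
by rewrite -adist_eq0; have := adist_le2 G u v; case: adist => [|[|[|]]].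
Qed.

Lemma adj_resolving_order (G : sgraph) (S : {set G}) :
  adj_resolving S -> #|G| <= #|S| + 2 ^ #|S|.
Proof.
move/injectiveP => injS; rewrite -(cardsC S) leq_add2l -card_powerset.
(* [N] will inject the complement of [S] into the powerset of [S]. *)
pose N u := [set s in S | adist u s == 1].
rewrite -(@card_in_imset _ _ N).
  apply/subset_leq_card/subsetP => _ /imsetP[u _ ->]; rewrite inE.
  by apply/subsetP => s; rewrite inE => /andP[].
move=> u v; rewrite !inE => uS vS /setP Nuv; apply: injS.
apply/eq_in_map => s; rewrite mem_enum => sS.
(* Outside [S] no coordinate is 0, so [N u = N v] forces equal vectors. *)
have neqS w : w \notin S -> w != s by apply: contraNneq => ->.
have := Nuv s; rewrite !inE sS /= => euv.
by rewrite (adist_neq _ _ _ (neqS _ uS)) (adist_neq _ _ _ (neqS _ vS)) euv.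
Qed.

Lemma ft_adj_resolvingT (G : sgraph) :
  0 < #|G| -> @ft_adj_resolving G setT.
Proof.
move=> G0; rewrite /ft_adj_resolving -card_gt0 cardsT G0.
by apply/forall_inP => s _; apply: adj_resolvingD1.
Qed.

Theorem theorem17 (G : sgraph) (hG : 1 < #|G|) :
  ftadim G <= adim G + 2 ^ adim G.
Proof.
have [[S rS <-] _] := adimP G.
have [_ ftmin] := ftadimP (ltnW hG).
(* Minimality against the candidate [setT] bounds [ftadim G] by the order of [G]. *)
apply: leq_trans (ftmin _ (ft_adj_resolvingT G (ltnW hG))) _.
by rewrite cardsT; apply: adj_resolving_order.
Qed.
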